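(* Let $r$ be a complex number such that $r^2\in\mathbb{Q}\setminus\{0\}$ (so $r$ is either real or purely imaginary). Then $r\tan r$ is irrational, i.e. $r\tan r\notin\mathbb{Q}$.
   Context: Here $\tan r=\sin r/\cos r$, where $\sin$ and $\cos$ are the entire complex functions. The case $r^2<0$ is included; writing $r=i\rho$ with $\rho$ real, one has $r\tan r=-\rho\tanh\rho$. *)

(* Defs.v *)
From Stdlib Require Import Reals Factorial QArith Qreals Lra Lia.
From Coquelicot Require Import Coquelicot.

Open Scope C_scope.

(* Sum of a complex series, taken on real and imaginary parts; it is the limit
   of the partial sums in C as soon as the series converges
   ([CSeries_correct]). *)
Definition CSeries (a : nat -> C) : C :=
  (Series (fun n => Re (a n)), Series (fun n => Im (a n))).

Definition Csin_term (z : C) (n : nat) : C :=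
  RtoC ((-1) ^ n / INR (fact (2 * n + 1)))%R * z ^ (2 * n + 1).

Definition Ccos_term (z : C) (n : nat) : C :=
  RtoC ((-1) ^ n / INR (fact (2 * n)))%R * z ^ (2 * n).

Definition Csin (z : C) : C := CSeries (Csin_term z).

Definition Ccos (z : C) : C := CSeries (Ccos_term z).

(* Where [Ccos z = 0] this takes the value [0], since [/ 0 = 0] in [C]: a
   statement that [z * Ctan z] is irrational thus includes [Ccos z <> 0]. *)
Definition Ctan (z : C) : C := Csin z / Ccos z.

Definition Crational (z : C) : Prop := exists q : Q, z = RtoC (Q2R q).

Lemma sum_n_Re_Im (a : nat -> C) (n : nat) :
  sum_n a n = (sum_n (fun k => Re (a k)) n, sum_n (fun k => Im (a k)) n).
Proof.
  induction n as [|n IH].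
  - rewrite !sum_O. now destruct (a O).
  - rewrite !sum_Sn, IH. reflexivity.
Qed.

Lemma is_series_Re_Im (a : nat -> C) (x y : R) :
  is_series (fun k => Re (a k)) x -> is_series (fun k => Im (a k)) y ->
  @is_series C_AbsRing C_NormedModule a (x, y).
Proof.
  intros Hx Hy.
  apply filterlim_ext with
    (fun n => (sum_n (fun k => Re (a k)) n, sum_n (fun k => Im (a k)) n)).
  { intros n. symmetry. apply sum_n_Re_Im. }
  intros P [e He].
  destruct (Hx (ball x e) (locally_ball x e)) as [N1 A].
  destruct (Hy (ball y e) (locally_ball y e)) as [N2 B].
  exists (max N1 N2). intros n Hn.
  apply He. split; [apply A | apply B]; lia.
Qed.

Lemma CSeries_correct (a : nat -> C) :
  @ex_series C_AbsRing C_NormedModule a ->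
  @is_series C_AbsRing C_NormedModule a (CSeries a).
Proof.
  intros [l Hl].
  apply is_series_Re_Im; apply Series_correct.
  - exists (Re l). intros P [e He].
    assert (H := Hl (fun z => P (Re z))).
    unfold filtermap in *.
    refine (filter_imp _ _ _ (H _)).
    + intros n. now rewrite sum_n_Re_Im.
    + exists e. intros y [Hy _]. now apply He.
  - exists (Im l). intros P [e He].
    assert (H := Hl (fun z => P (Im z))).
    unfold filtermap in *.
    refine (filter_imp _ _ _ (H _)).
    + intros n. now rewrite sum_n_Re_Im.
    + exists e. intros y [_ Hy]. now apply He.
Qed.

Lemma Cmod_real_coef (n m : nat) (z : C) :
  Cmod (RtoC ((-1) ^ n / INR (fact m))%R * z ^ m)
  = (Cmod z ^ m / INR (fact m))%R.
Proof.
  rewrite Cmod_mult, Cmod_pow, Cmod_R.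
  unfold Rdiv. rewrite Rabs_mult, pow_1_abs, Rabs_pos_eq.
  - ring.
  - apply Rlt_le, Rinv_0_lt_compat, INR_fact_lt_0.
Qed.

Lemma ex_series_exp_scal (c x : R) :
  ex_series (fun n => c * (x ^ n / INR (fact n)))%R.
Proof.
  apply (ex_series_scal_l (V := R_NormedModule)).
  exists (exp x).
  apply is_series_ext with (2 := proj1 (is_pseries_R _ _ _) (is_exp_Reals x)).
  intros n. unfold Rdiv. apply Rmult_comm.
Qed.

Lemma pow_fact_le (x : R) (n m : nat) :
  (0 <= x)%R -> (n <= m)%nat ->
  (x ^ m / INR (fact m) <= x ^ m / INR (fact n))%R.
Proof.
  intros Hx Hn. apply Rmult_le_compat_l.
  - now apply pow_le.
  - apply Rinv_le_contravar. apply INR_fact_lt_0.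
    now apply le_INR, fact_le.
Qed.

Lemma Csin_correct (z : C) :
  @is_series C_AbsRing C_NormedModule (Csin_term z) (Csin z).
Proof.
  apply CSeries_correct.
  apply (ex_series_le (V := C_CompleteNormedModule)) with
    (2 := ex_series_exp_scal (Cmod z) (Cmod z ^ 2)).
  intros n. change (Cmod (Csin_term z n) <= Cmod z * ((Cmod z ^ 2) ^ n / INR (fact n)))%R.
  unfold Csin_term. rewrite Cmod_real_coef.
  eapply Rle_trans. apply pow_fact_le with (n := n). apply Cmod_ge_0. lia.
  rewrite pow_add, pow_mult. apply Req_le. simpl. unfold Rdiv. ring.
Qed.

Lemma Ccos_correct (z : C) :
  @is_series C_AbsRing C_NormedModule (Ccos_term z) (Ccos z).
Proof.
  apply CSeries_correct.
  apply (ex_series_le (V := C_CompleteNormedModule)) with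
    (2 := ex_series_exp_scal 1 (Cmod z ^ 2)).
  intros n. change (Cmod (Ccos_term z n) <= 1 * ((Cmod z ^ 2) ^ n / INR (fact n)))%R.
  unfold Ccos_term. rewrite Cmod_real_coef.
  eapply Rle_trans. apply pow_fact_le with (n := n). apply Cmod_ge_0. lia.
  rewrite pow_mult. apply Req_le. ring.
Qed.

(* Main.v *)
(** Put [x = - r^2] and [G_k = sum_n x^n / (2^n n! (2n+2k-1)!!)], so that
    [cos r = G_0] and [sin r = r G_1].  Comparing coefficients gives
    [G_k = (2k+1) G_(k+1) + x G_(k+2)].  Write [r^2 = a/b].  If [r tan r] were
    rational (or [cos r = 0]), then [G_0] and [G_1] would be integer multiples
    of one real [l], hence by the recurrence so would every [a^k G_k].  But
    [(2k-1)!! G_k] tends to [1]: thus [a^k G_k] is nonzero for large [k] and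
    tends to [0], which is impossible for multiples of [l]. *)

Require Import Defs.
From Stdlib Require Import Reals QArith Qreals.
From Stdlib Require Import Factorial Lra Lia.
From Coquelicot Require Import Coquelicot.

Open Scope R_scope.

(** * Odd double factorials and their link with factorials *)

(* [odd_fact k] is [(2k-1)!!]. *)
Fixpoint odd_fact (k : nat) : R :=
  match k with
  | O => 1
  | S j => (2 * INR j + 1) * odd_fact j
  end.

Lemma odd_fact_pos (k : nat) : 0 < odd_fact k.
Proof.
  induction k as [|k IH]; simpl; [lra|].
  apply Rmult_lt_0_compat; [pose proof (pos_INR k); lra | exact IH].
Qed.

Lemma odd_fact_add_ge (n k : nat) : odd_fact k <= odd_fact (n + k).
Proof.
  induction n as [|n IH]; [apply Rle_refl|].
  change (odd_fact k <= (2 * INR (n + k) + 1) * odd_fact (n + k)).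
  pose proof (pos_INR (n + k)); pose proof (odd_fact_pos (n + k)); nra.
Qed.

Lemma fact_le_odd_fact (k : nat) : INR (fact k) <= odd_fact k.
Proof.
  induction k as [|k IH]; [simpl; lra|].
  rewrite fact_simpl, mult_INR, S_INR.
  change (odd_fact (S k)) with ((2 * INR k + 1) * odd_fact k).
  pose proof (pos_INR k).
  apply Rmult_le_compat; [lra | apply pos_INR | lra | exact IH].
Qed.

Lemma fact_double (n : nat) :
  INR (fact (2 * n)) = 2 ^ n * INR (fact n) * odd_fact n.
Proof.
  induction n as [|n IH]; [simpl; lra|].
  replace (2 * S n)%nat with (S (S (2 * n))) by lia.
  rewrite !fact_simpl, !mult_INR, IH, !S_INR, mult_INR.
  simpl; ring.
Qed.

Lemma fact_double_succ (n : nat) :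
  INR (fact (2 * n + 1)) = 2 ^ n * INR (fact n) * odd_fact (n + 1).
Proof.
  rewrite !Nat.add_1_r, fact_simpl, mult_INR, fact_double, S_INR, mult_INR.
  simpl; ring.
Qed.

(** * The series G_k: convergence and three-term recurrence *)

(** For [x = - r^2] with [r] nonzero, [G x k] is j_(k-1)(r) / r^(k-1), where j denotes the spherical
    Bessel functions. *)
Definition G_term (x : R) (k n : nat) : R :=
  x ^ n / (2 ^ n * INR (fact n) * odd_fact (n + k)).

Definition G (x : R) (k : nat) : R := Series (G_term x k).

(** The bound [d] is left free: [odd_fact k] yields convergence, while [odd_fact (S k)] bounds the
    terms after the first and gains a factor [2k+1] in [G_asymptotic]. *)
Lemma Rabs_G_term_le (x : R) (k n : nat) (d : R) :
  0 < d <= odd_fact (n + k) ->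
  Rabs (G_term x k n) <= / d * (Rabs x ^ n / INR (fact n)).
Proof.
  intros [Hd Hdn]. unfold G_term.
  pose proof (INR_fact_lt_0 n) as Hf.
  assert (H2 : 1 <= 2 ^ n) by (apply pow_R1_Rle; lra).
  assert (Hpos : 0 < INR (fact n) * d) by nra.
  assert (Hle : INR (fact n) * d <= 2 ^ n * INR (fact n) * odd_fact (n + k)).
  { apply Rmult_le_compat; nra. }
  unfold Rdiv. rewrite Rabs_mult, <- RPow_abs.
  rewrite (Rabs_pos_eq (/ _)) by (apply Rlt_le, Rinv_0_lt_compat; lra).
  replace (/ d * (Rabs x ^ n * / INR (fact n)))
    with (Rabs x ^ n * / (INR (fact n) * d)) by (field; lra).
  apply Rmult_le_compat_l; [apply pow_le, Rabs_pos|].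
  now apply Rinv_le_contravar.
Qed.

Lemma ex_series_Rabs_G_term (x : R) (k : nat) :
  ex_series (fun n => Rabs (G_term x k n)).
Proof.
  apply (ex_series_le (V := R_CompleteNormedModule)) with
    (2 := ex_series_exp_scal (/ odd_fact k) (Rabs x)).
  intros n. change (Rabs (Rabs (G_term x k n)) <= / odd_fact k * (Rabs x ^ n / INR (fact n))).
  rewrite Rabs_Rabsolu. apply Rabs_G_term_le.
  split; [apply odd_fact_pos | apply odd_fact_add_ge].
Qed.

Lemma ex_series_G_term (x : R) (k : nat) : ex_series (G_term x k).
Proof. apply ex_series_Rabs, ex_series_Rabs_G_term. Qed.

(** Split the last factor of [odd_fact (n + k + 2)] as [(2k+1) + 2(n+1)]; the summand [2(n+1)]
    cancels in [2^(n+1) (n+1)!]. *)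
Lemma G_term_recurrence (x : R) (k n : nat) :
  G_term x k (S n)
  = (2 * INR k + 1) * G_term x (S k) (S n) + x * G_term x (S (S k)) n.
Proof.
  unfold G_term.
  replace (n + S (S k))%nat with (S (S n + k)) by lia.
  replace (S n + S k)%nat with (S (S n + k)) by lia.
  change (odd_fact (S (S n + k)))
    with ((2 * INR (S n + k) + 1) * odd_fact (S n + k)).
  pose proof (odd_fact_pos (S n + k)).
  pose proof (INR_fact_lt_0 n).
  assert (2 ^ n <> 0) by (apply pow_nonzero; lra).
  rewrite fact_simpl, mult_INR, plus_INR, S_INR.
  pose proof (pos_INR n); pose proof (pos_INR k).
  change (2 ^ S n) with (2 * 2 ^ n). change (x ^ S n) with (x * x ^ n).
  field. repeat split; lra.
Qed.

Lemma G_recurrence (x : R) (k : nat) :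
  G x k = (2 * INR k + 1) * G x (S k) + x * G x (S (S k)).
Proof.
  unfold G.
  rewrite (Series_incr_1 (G_term x k)), (Series_incr_1 (G_term x (S k)))
    by apply ex_series_G_term.
  rewrite (Series_ext _ _ (G_term_recurrence x k)).
  rewrite Series_plus, !Series_scal_l.
  (* The constant terms match on their own, since [x * G x (S (S k))] starts in degree 1. *)
  - replace (G_term x k 0) with ((2 * INR k + 1) * G_term x (S k) 0); [ring|].
    unfold G_term; simpl.
    pose proof (odd_fact_pos k); pose proof (pos_INR k).
    field; lra.
  - apply (ex_series_scal_l (V := R_NormedModule)).
    apply (ex_series_incr_1 (G_term x (S k))), ex_series_G_term.
  - apply (ex_series_scal_l (V := R_NormedModule)), ex_series_G_term.
Qed.

(** * Behaviour of G_k for large k *)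

(** The constant term of [odd_fact k * G x k] is 1. Every later denominator has the factor [2k+1]
    beyond [odd_fact k], and what remains is dominated by the exponential series without its first
    term, so [exp |x| - 1] serves as [M] for all [k]. *)
Lemma G_asymptotic (x : R) :
  exists M : R, forall k : nat,
    Rabs (odd_fact k * G x k - 1) <= M / (2 * INR k + 1).
Proof.
  set (b := fun n => Rabs x ^ S n / INR (fact (S n))).
  assert (Hb : ex_series b).
  { apply (ex_series_incr_1 (fun n => Rabs x ^ n / INR (fact n))).
    apply ex_series_ext with (2 := ex_series_exp_scal 1 (Rabs x)).
    intros n. apply Rmult_1_l. }
  exists (Series b). intros k.
  pose proof (odd_fact_pos k) as Hk; pose proof (pos_INR k) as Hk0.
  unfold G. rewrite Series_incr_1 by apply ex_series_G_term.
  replace (odd_fact k * (G_term x k 0 + Series (fun n => G_term x k (S n))) - 1)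
    with (odd_fact k * Series (fun n => G_term x k (S n)))
    by (unfold G_term; simpl; field; lra).
  rewrite Rabs_mult, (Rabs_pos_eq (odd_fact k)) by lra.
  replace (Series b / (2 * INR k + 1))
    with (odd_fact k * (/ ((2 * INR k + 1) * odd_fact k) * Series b))
    by (field; lra).
  apply Rmult_le_compat_l; [lra|].
  rewrite <- Series_scal_l.
  eapply Rle_trans.
  - apply Series_Rabs.
    apply (ex_series_incr_1 (fun n => Rabs (G_term x k n))).
    apply ex_series_Rabs_G_term.
  - apply Series_le; [|now apply (ex_series_scal_l (V := R_NormedModule))].
    intros n. split; [apply Rabs_pos|].
    apply Rabs_G_term_le. split.
    + apply Rmult_lt_0_compat; lra.
    + change ((2 * INR k + 1) * odd_fact k) with (odd_fact (S k)).
      replace (S n + k)%nat with (n + S k)%nat by lia.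
      apply odd_fact_add_ge.
Qed.

(** Once [M < 2k+1], the product [odd_fact k * G x k] lies strictly between 0 and 2. Weakening
    [odd_fact k] to [k!] prepares the comparison with powers in [cv_speed_pow_fact]. *)
Lemma G_eventually_small_nonzero (x : R) :
  exists N : nat, forall k : nat, (N <= k)%nat ->
    G x k <> 0 /\ Rabs (G x k) <= 2 / INR (fact k).
Proof.
  destruct (G_asymptotic x) as [M HM].
  destruct (INR_unbounded M) as [N HN].
  exists N. intros k Hk.
  apply le_INR in Hk. specialize (HM k).
  pose proof (odd_fact_pos k) as Hd; pose proof (pos_INR k) as Hk0.
  pose proof (INR_fact_lt_0 k) as Hf; pose proof (fact_le_odd_fact k) as Hfd.
  assert (HM1 : M / (2 * INR k + 1) < 1).
  { apply Rlt_div_l; lra. }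
  assert (H1 : Rabs (odd_fact k * G x k - 1) < 1) by lra.
  apply Rabs_def2 in H1. destruct H1 as [Hlt Hgt].
  assert (HG : 0 < G x k) by nra.
  split; [lra|].
  rewrite Rabs_pos_eq by lra.
  apply Rle_div_r; [exact Hf | nra].
Qed.

(** * Integrality against smallness *)

Lemma G_integer_multiples (a b : Z) (x l : R) (u v : Z) :
  IZR a = - x * IZR b ->
  G x 0 = l * IZR u -> G x 1 = l * IZR v ->
  forall k : nat, exists w : Z, IZR a ^ k * G x k = l * IZR w.
Proof.
  intros Hab H0 H1 k.
  enough (H : (exists w : Z, IZR a ^ k * G x k = l * IZR w) /\
              (exists w : Z, IZR a ^ S k * G x (S k) = l * IZR w)) by apply H.
  induction k as [|k [[w Hw] [w' Hw']]].
  - split; [exists u | exists (a * v)%Z]; rewrite ?mult_IZR, ?H0, ?H1; simpl; ring.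
  - split; [now exists w'|].
    (* Solve the recurrence for [x * G x (S (S k))] and multiply by [- b * a^(k+1)]: since
       [a = - x * b], the left side becomes [a^(k+2) * G x (k+2)]. *)
    exists (b * ((2 * Z.of_nat k + 1) * w' - a * w))%Z.
    rewrite !mult_IZR, minus_IZR, !mult_IZR, plus_IZR, mult_IZR, <- INR_IZR_INZ.
    pose proof (G_recurrence x k) as HG.
    transitivity (IZR b * ((2 * INR k + 1) * (IZR a ^ S k * G x (S k))
                           - IZR a * (IZR a ^ k * G x k))).
    + rewrite HG. simpl. rewrite Hab at 1. ring.
    + rewrite Hw, Hw'. ring.
Qed.

Lemma G_0_1_incommensurable (a b : Z) (x l : R) (u v : Z) :
  x <> 0 -> b <> 0%Z -> IZR a = - x * IZR b ->
  G x 0 = l * IZR u -> G x 1 = l * IZR v -> False.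
Proof.
  intros Hx Hb Hab H0 H1.
  pose proof (G_integer_multiples a b x l u v Hab H0 H1) as Hint.
  assert (Ha : IZR a <> 0).
  { rewrite Hab. apply Rmult_integral_contrapositive.
    split; [lra | now apply not_0_IZR]. }
  destruct (G_eventually_small_nonzero x) as [N HN].
  (* A nonzero integer multiple of [l] has absolute value at least [|l|]. *)
  assert (Hw : forall k, (N <= k)%nat -> l <> 0 /\ Rabs l <= Rabs (IZR a ^ k * G x k)).
  { intros k Hk. destruct (HN k Hk) as [Hne _]. destruct (Hint k) as [w Hw].
    assert (Hp : l * IZR w <> 0).
    { rewrite <- Hw. apply Rmult_integral_contrapositive.
      split; [now apply pow_nonzero | exact Hne]. }
    split; [intros E; apply Hp; rewrite E; ring|].
    rewrite Hw, Rabs_mult, <- abs_IZR.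
    assert (1 <= IZR (Z.abs w)).
    { apply IZR_le. destruct (Z.eq_dec w 0) as [->|]; [|lia].
      exfalso; apply Hp; ring. }
    pose proof (Rabs_pos l); nra. }
  assert (Hl : 0 < Rabs l) by (apply Rabs_pos_lt, (Hw N (le_n N))).
  (* Half of [|l|], because the bound on [G x k] carries a factor 2. *)
  destruct (cv_speed_pow_fact (IZR a) (Rabs l / 2)) as [K HK]; [lra|].
  set (k := max N K).
  specialize (HK k (Nat.le_max_r N K)).
  destruct (HN k (Nat.le_max_l N K)) as [_ Hs].
  destruct (Hw k (Nat.le_max_l N K)) as [_ Hlow].
  unfold R_dist in HK. rewrite Rminus_0_r in HK.
  unfold Rdiv in HK, Hs. rewrite Rabs_mult in HK, Hlow.
  rewrite (Rabs_pos_eq (/ _)) in HK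
    by (apply Rlt_le, Rinv_0_lt_compat, INR_fact_lt_0).
  pose proof (Rabs_pos (IZR a ^ k)).
  assert (Rabs (IZR a ^ k) * Rabs (G x k)
          <= Rabs (IZR a ^ k) * (2 * / INR (fact k)))
    by (now apply Rmult_le_compat_l).
  lra.
Qed.

(** * Cosine and sine in terms of G_0 and G_1 *)

Lemma opp_pow (t : R) (n : nat) : (- t) ^ n = (-1) ^ n * t ^ n.
Proof. rewrite <- Rpow_mult_distr. f_equal. ring. Qed.

Lemma CSeries_scal_RtoC (z : C) (a : nat -> R) :
  CSeries (fun n => z * RtoC (a n))%C = (z * RtoC (Series a))%C.
Proof.
  unfold CSeries. destruct z as [p q]. unfold Cmult, RtoC; simpl.
  rewrite (Series_ext (fun n => p * a n - q * 0) (fun n => p * a n))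
    by (intros; ring).
  rewrite (Series_ext (fun n => p * 0 + q * a n) (fun n => q * a n))
    by (intros; ring).
  rewrite !Series_scal_l. f_equal; ring.
Qed.

Lemma CSeries_ext (a b : nat -> C) :
  (forall n, a n = b n) -> CSeries a = CSeries b.
Proof.
  intros H. unfold CSeries. f_equal; apply Series_ext; intros n; now rewrite H.
Qed.

(** Apart from one factor [r] in the sine, both series involve [r] only through [r^2], so the real
    function [G] treats real and imaginary [r] alike. *)
Lemma Ccos_G (r : C) (t : R) : (r ^ 2)%C = RtoC t -> Ccos r = RtoC (G (- t) 0).
Proof.
  intros Hr. unfold Ccos, G.
  rewrite <- (Cmult_1_l (RtoC (Series _))), <- CSeries_scal_RtoC.
  apply CSeries_ext. intros n. unfold Ccos_term, G_term.
  rewrite Cpow_mult_r, Hr, <- RtoC_pow, <- RtoC_mult, Cmult_1_l. f_equal.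
  rewrite fact_double, Nat.add_0_r, opp_pow. unfold Rdiv. ring.
Qed.

Lemma Csin_G (r : C) (t : R) :
  (r ^ 2)%C = RtoC t -> Csin r = (r * RtoC (G (- t) 1))%C.
Proof.
  intros Hr. unfold Csin, G.
  rewrite <- CSeries_scal_RtoC.
  apply CSeries_ext. intros n. unfold Csin_term, G_term.
  rewrite Cpow_add_r, Cpow_mult_r, Hr, Cpow_1_r, <- RtoC_pow.
  rewrite Cmult_assoc, <- RtoC_mult, Cmult_comm. do 2 f_equal.
  rewrite fact_double_succ, opp_pow. unfold Rdiv. ring.
Qed.

Theorem theorem1 :
  forall r : C,
    (r ^ 2)%C <> RtoC 0 ->
    Crational (r ^ 2)%C ->
    ~ Crational (r * Ctan r)%C.
Proof.
  intros r Hr0 [[a b] Hr] [[p q] Hq].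
  unfold Q2R in Hr, Hq; cbn [Qnum Qden] in Hr, Hq.
  set (t := IZR a * / IZR (Z.pos b)) in *.
  set (s := IZR p * / IZR (Z.pos q)) in *.
  assert (Hb : IZR (Z.pos b) <> 0) by (now apply not_0_IZR).
  assert (Hqq : IZR (Z.pos q) <> 0) by (now apply not_0_IZR).
  assert (Ht : t <> 0) by (intros E; apply Hr0; now rewrite Hr, E).
  assert (Hat : IZR a = - - t * IZR (Z.pos b)) by (unfold t; field; exact Hb).
  assert (Ha : IZR a <> 0) by (rewrite Hat; nra).
  assert (Hx : - t <> 0) by lra.
  unfold Ctan in Hq.
  rewrite (Ccos_G r t Hr), (Csin_G r t Hr) in Hq.
  destruct (Req_dec (G (- t) 0) 0) as [H0|H0].
  (* Here cos r = 0 and [Hq] carries no information, as [Ctan r] has its default value; take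
     [l = G_1], with multiples 0 and 1. *)
  - apply (G_0_1_incommensurable a (Z.pos b) (- t) (G (- t) 1) 0 1 Hx);
      [discriminate | exact Hat | rewrite H0; ring | ring].
  - assert (Hs : t * (G (- t) 1 / G (- t) 0) = s).
    { apply RtoC_inj. rewrite <- Hq, RtoC_mult, <- Hr, RtoC_div by exact H0.
      unfold Cdiv. ring. }
    assert (HG1 : G (- t) 1 = s / t * G (- t) 0) by (rewrite <- Hs; field; lra).
    (* With [t = a/b] and [s = p/q], [G_1 / G_0 = s/t = (p b) / (q a)], hence this [l] and these two
       multiples. *)
    apply (G_0_1_incommensurable a (Z.pos b) (- t)
             (G (- t) 0 / (IZR (Z.pos q) * IZR a))
             (Z.pos q * a) (p * Z.pos b) Hx);
      [discriminate | exact Hat | |].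
    + rewrite mult_IZR. field. lra.
    + rewrite HG1, mult_IZR. unfold s, t. field. lra.
Qed.
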